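(* Let $m,l,\hbar>0$ and $\mu\in\mathbb{N}$ ($\mu\ge1$). For $\beta>0$ let $f^1_{\mu,\beta}(x,t)=|\Psi_{\mu,\beta}(x,t)|^2$. Then for $0\le x\le l$ and $t\in\mathbb{R}$ $$\lim_{\beta\to+\infty}f^1_{\mu,\beta}(x,t)=f^1_\mu(x),\qquad f^1_\mu(x)=\frac{2}{l}\sin^2\!\left(\frac{\pi\mu}{l}x\right).$$
   Context: $\theta_1(z,\tau)=\sum_{k\in\mathbb{Z}}e^{\,i\frac{\pi\tau}{4}(2k+1)^2+i\frac{\pi}{2}(2z+1)(2k+1)}$ for $z\in\mathbb{C}$, $\operatorname{Im}\tau>0$. $N(\beta)=l\sum_{k\in\mathbb{Z}}e^{-\frac{\pi\beta}{2}(2k+1)^2}$. $\Psi_{\mu,\beta}(x,t)=\frac{1}{\sqrt{N(\beta)}}\theta_1\left(\mu\frac{x}{l},-\mu^2\frac{2\pi\hbar}{ml^2}t+i\beta\right)$. *)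

(* Defs.v *)
From Stdlib Require Import Reals Lra Lia ZArith.
From Coquelicot Require Import Coquelicot.
Open Scope R_scope.

Definition Cexp (z : C) : C := (exp (Re z) * cos (Im z), exp (Re z) * sin (Im z)).

(* Sum over all integers: the indices k >= 0 and k <= -1 are summed separately.
   As with [Series], the value is only meaningful when both halves converge;
   [ex_series_theta1_term] and [ex_series_theta_norm_term] below show that they
   do, absolutely, in the intended domains. *)
Definition SeriesZ (a : Z -> R) : R :=
  Series (fun n => a (Z.of_nat n)) + Series (fun n => a (- Z.of_nat n - 1)%Z).

Definition CSeriesZ (a : Z -> C) : C :=
  (SeriesZ (fun k => Re (a k)), SeriesZ (fun k => Im (a k))).

Definition theta1_term (z tau : C) (k : Z) : C :=
  Cexp (Ci * (PI * tau / 4) * RtoC ((2 * IZR k + 1) ^ 2)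
        + Ci * (PI / 2) * (2 * z + 1) * RtoC (2 * IZR k + 1))%C.

Definition theta1 (z tau : C) : C := CSeriesZ (theta1_term z tau).

Definition theta_norm_term (beta : R) (k : Z) : R :=
  exp (- (PI * beta / 2) * (2 * IZR k + 1) ^ 2).

Definition theta_norm (l beta : R) : R := l * SeriesZ (theta_norm_term beta).

Definition Psi (m l hbar : R) (mu : nat) (beta x t : R) : C :=
  (RtoC (1 / sqrt (theta_norm l beta)) *
   theta1 (RtoC (INR mu * (x / l)))
          (RtoC (- (INR mu ^ 2) * (2 * PI * hbar / (m * l ^ 2)) * t) + Ci * beta))%C.

Definition density (m l hbar : R) (mu : nat) (beta x t : R) : R :=
  Cmod (Psi m l hbar mu beta x t) ^ 2.

Definition box_density (l : R) (mu : nat) (x : R) : R :=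
  2 / l * sin (PI * INR mu / l * x) ^ 2.

Lemma Cmod_Cexp (z : C) : Cmod (Cexp z) = exp (Re z).
Proof.
unfold Cmod, Cexp; simpl fst; simpl snd.
replace ((exp (Re z) * cos (Im z)) ^ 2 + (exp (Re z) * sin (Im z)) ^ 2)
  with (exp (Re z) ^ 2).
- rewrite <- Rsqr_pow2; apply sqrt_Rsqr, Rlt_le, exp_pos.
- assert (H := sin2_cos2 (Im z)); unfold Rsqr in H.
  transitivity (exp (Re z) ^ 2 * (sin (Im z) * sin (Im z) + cos (Im z) * cos (Im z)));
    [rewrite H|]; ring.
Qed.

Lemma Cmod_theta1_term (z tau : C) (k : Z) :
  Cmod (theta1_term z tau k) =
  exp (- (PI * Im tau / 4) * (2 * IZR k + 1) ^ 2 - PI * Im z * (2 * IZR k + 1)).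
Proof.
unfold theta1_term; rewrite Cmod_Cexp; f_equal.
unfold Re, Im, Cdiv, Cinv, Cmult, Cplus, Ci, RtoC; simpl; field.
Qed.

Lemma ex_series_gauss (a b : R) (s : nat -> R) :
  0 < a -> (forall n, INR n <= Rabs (s n)) ->
  ex_series (fun n => exp (- a * s n ^ 2 - b * s n)).
Proof.
intros ha hs.
set (c := Rabs b + 1).
apply (@ex_series_le R_AbsRing R_CompleteNormedModule) with (b := fun n => exp (c ^ 2 / (4 * a)) * exp (-1) ^ n).
- intros n; unfold norm; simpl; unfold abs; simpl.
  rewrite Rabs_right by (apply Rle_ge, Rlt_le, exp_pos).
  replace (exp (-1) ^ n) with (exp (- INR n))
    by (rewrite <- Rpower_pow by apply exp_pos; unfold Rpower; rewrite ln_exp;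
        f_equal; ring).
  rewrite <- exp_plus.
  enough (H : - a * s n ^ 2 - b * s n <= c ^ 2 / (4 * a) + - INR n)
    by (destruct H as [H|H]; [now left; apply exp_increasing | right; f_equal; exact H]).
  assert (hb : - b * s n <= Rabs b * Rabs (s n)).
  { rewrite <- Rabs_mult, <- (Rabs_Ropp (b * s n)).
    eapply Rle_trans; [|apply Rle_abs]; lra. }
  rewrite <- (pow2_abs (s n)); specialize (hs n).
  set (u := Rabs (s n)) in *.
  assert (h : 0 <= a * (u - c / (2 * a)) ^ 2)
    by (apply Rmult_le_pos; [lra | apply pow2_ge_0]).
  replace (a * (u - c / (2 * a)) ^ 2) with (a * u ^ 2 - c * u + c ^ 2 / (4 * a)) in h
    by (field; lra).
  unfold c in h at 1; lra.
- apply (@ex_series_scal_l R_AbsRing R_NormedModule), ex_series_geom.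
  rewrite Rabs_right by (apply Rle_ge, Rlt_le, exp_pos).
  rewrite <- exp_0; apply exp_increasing; lra.
Qed.

Lemma ex_series_theta1_term (z tau : C) : 0 < Im tau ->
  ex_series (fun n => Cmod (theta1_term z tau (Z.of_nat n))) /\
  ex_series (fun n => Cmod (theta1_term z tau (- Z.of_nat n - 1))).
Proof.
intros htau.
assert (ha : 0 < PI * Im tau / 4) by (assert (h := PI_RGT_0); nra).
split.
- apply ex_series_ext with (2 := ex_series_gauss _ (PI * Im z)
    (fun n => 2 * IZR (Z.of_nat n) + 1) ha
    ltac:(intros n; cbv beta; rewrite <- INR_IZR_INZ; assert (h := pos_INR n);
          rewrite Rabs_right; lra)).
  intros n; now rewrite Cmod_theta1_term.
- apply ex_series_ext with (2 := ex_series_gauss _ (PI * Im z)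
    (fun n => 2 * IZR (- Z.of_nat n - 1) + 1) ha
    ltac:(intros n; cbv beta; rewrite minus_IZR, opp_IZR, <- INR_IZR_INZ;
          assert (h := pos_INR n); rewrite Rabs_left; lra)).
  intros n; now rewrite Cmod_theta1_term.
Qed.

Lemma ex_series_theta_norm_term (beta : R) : 0 < beta ->
  ex_series (fun n => theta_norm_term beta (Z.of_nat n)) /\
  ex_series (fun n => theta_norm_term beta (- Z.of_nat n - 1)).
Proof.
intros hbeta.
destruct (ex_series_theta1_term 0 (Ci * (2 * beta))%C) as [h1 h2].
{ unfold Im, Cmult, Ci, RtoC; simpl; lra. }
assert (E : forall k, Cmod (theta1_term 0 (Ci * (2 * beta))%C k) = theta_norm_term beta k).
{ intros k; rewrite Cmod_theta1_term; unfold theta_norm_term; f_equal.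
  unfold Im, Cmult, Ci, RtoC; simpl; field. }
split.
- now apply ex_series_ext with (2 := h1).
- now apply ex_series_ext with (2 := h2).
Qed.

(* Main.v *)
(** As [beta] grows, the terms [k = 0] and [k = -1] of both theta series, of
    common size [q = exp (- c beta)], dominate: the other terms add up to at most
    [2 q r / (1 - r)] with [r = exp (- 8 c beta)], because
    [(2 n + 3) ^ 2 - 1 >= 8 (n + 1)].  Here [c = PI / 4] for [theta1] and
    [c = PI / 2] for the normalization.  In the quotient defining the density, the
    factor [exp (- PI beta / 2)] and the time-dependent phase [exp (i PI s / 4)]
    cancel, and the two leading terms [exp (+- i (PI z + PI / 2))] add up to
    [- 2 sin (PI z)]. *)

Require Import Defs.
From Stdlib Require Import Reals.
From Coquelicot Require Import Coquelicot.
From Stdlib Require Import Lra ZArith.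
Open Scope R_scope.

(** The geometric domination serves twice: it gives the summability without which the first term
    could not be split off [Series], and it bounds what remains. *)
Lemma Series_geom_tail_bound (a : nat -> R) (C r : R) :
  0 < r < 1 -> (forall n, Rabs (a (S n)) <= C * r ^ n) ->
  Rabs (Series a - a 0%nat) <= C / (1 - r).
Proof.
intros hr ha.
assert (hg : is_series (fun n => C * r ^ n) (C / (1 - r))).
{ apply (@is_series_scal R_AbsRing R_NormedModule C (fun n => r ^ n) (/ (1 - r))).
  apply is_series_geom; rewrite Rabs_right; lra. }
assert (hex : ex_series (fun n => Rabs (a (S n)))).
{ apply (@ex_series_le R_AbsRing R_CompleteNormedModule) with (b := fun n => C * r ^ n).
  - intros n; unfold norm; simpl; unfold abs; simpl; rewrite Rabs_Rabsolu; apply ha.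
  - eexists; exact hg. }
rewrite Series_incr_1
  by (apply ex_series_incr_1, ex_series_Rabs; exact hex).
replace (a 0%nat + Series (fun k => a (S k)) - a 0%nat)
  with (Series (fun k => a (S k))) by ring.
eapply Rle_trans; [apply Series_Rabs, hex|].
rewrite <- (is_series_unique _ _ hg).
apply Series_le; [|eexists; exact hg].
intros n; split; [apply Rabs_pos | apply ha].
Qed.

Lemma gauss_le_geom (c s : R) (n : nat) :
  0 < c -> 2 * INR n + 3 <= Rabs s ->
  exp (- c * s ^ 2) <= exp (- c) * exp (- (8 * c)) * exp (- (8 * c)) ^ n.
Proof.
intros hc hs.
replace (exp (- (8 * c)) ^ n) with (exp (- (8 * c) * INR n))
  by (rewrite <- Rpower_pow by apply exp_pos; unfold Rpower; rewrite ln_exp;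
      f_equal; ring).
rewrite <- !exp_plus, <- (pow2_abs s).
assert (hn := pos_INR n).
(* Squaring the hypothesis gives [4 n^2 + 12 n + 9]; the linear lower bound makes the exponent
   affine in [n], hence geometric. *)
assert (h : 8 * INR n + 9 <= Rabs s ^ 2) by nra.
destruct (Rle_lt_or_eq_dec (- c * Rabs s ^ 2) (- c + - (8 * c) + - (8 * c) * INR n))
  as [h'|h']; [nra | now left; apply exp_increasing | now right; f_equal].
Qed.

(** Each half of the integer sum contributes one leading term and one geometric tail, whence the
    factor 2. Scaling by [exp c] cancels the common size of the leading terms and leaves an error
    that vanishes as [c] grows. *)
Lemma SeriesZ_gauss_tail (a : Z -> R) (c : R) :
  0 < c -> (forall k, Rabs (a k) <= exp (- c * (2 * IZR k + 1) ^ 2)) ->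
  Rabs (exp c * SeriesZ a - exp c * (a 0%Z + a (-1)%Z))
    <= 2 * (exp (- (8 * c)) / (1 - exp (- (8 * c)))).
Proof.
intros hc ha.
set (r := exp (- (8 * c))).
assert (hr : 0 < r < 1).
{ split; [apply exp_pos|]; unfold r; rewrite <- exp_0; apply exp_increasing; lra. }
assert (h1 := Series_geom_tail_bound (fun n => a (Z.of_nat n)) (exp (- c) * r) r hr).
assert (h2 := Series_geom_tail_bound (fun n => a (- Z.of_nat n - 1)%Z) (exp (- c) * r) r hr).
cbv beta in h1, h2; simpl (Z.of_nat 0) in h1, h2; simpl (- 0 - 1)%Z in h2.
(* Past the leading terms, the indices are [k = n + 1] in one half and [k = - n - 2] in the other,
   so [2 k + 1] is [2 n + 3] or its opposite. *)
specialize (h1 ltac:(intros n; eapply Rle_trans; [apply ha|]; apply gauss_le_geom;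
  [exact hc|]; rewrite <- INR_IZR_INZ, S_INR; assert (h := pos_INR n);
  rewrite Rabs_right; lra)).
specialize (h2 ltac:(intros n; eapply Rle_trans; [apply ha|]; apply gauss_le_geom;
  [exact hc|]; rewrite minus_IZR, opp_IZR, <- INR_IZR_INZ, S_INR;
  assert (h := pos_INR n); rewrite Rabs_left; lra)).
rewrite <- Rmult_minus_distr_l, Rabs_mult, (Rabs_right (exp c))
  by (apply Rle_ge, Rlt_le, exp_pos).
assert (hT : Rabs (SeriesZ a - (a 0%Z + a (-1)%Z)) <= 2 * (exp (- c) * r / (1 - r))).
{ unfold SeriesZ.
  match type of h1 with Rabs ?u <= _ => match type of h2 with Rabs ?v <= _ =>
    match goal with |- Rabs ?w <= _ => replace w with (u + v) by ring end;
    assert (h3 := Rabs_triang u v) end end.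
  lra. }
replace (2 * (r / (1 - r))) with (exp c * (2 * (exp (- c) * r / (1 - r)))).
- apply Rmult_le_compat_l; [apply Rlt_le, exp_pos | exact hT].
- rewrite exp_Ropp; field; split; [lra | apply Rgt_not_eq, exp_pos].
Qed.

Lemma is_lim_exp_neg_lin (c : R) :
  0 < c -> is_lim (fun beta => exp (- (c * beta))) p_infty 0.
Proof.
intros hc.
apply is_lim_comp with (l := m_infty).
- apply is_lim_exp_m.
- replace m_infty with (Rbar_opp (Rbar_mult c p_infty)).
  + apply is_lim_opp, is_lim_scal_l, is_lim_id.
  + simpl; destruct (Rle_dec 0 c) as [h|h]; [|lra].
    destruct (Rle_lt_or_eq_dec 0 c h); [reflexivity | lra].
(* Composition requires the inner function to avoid its limit; a finite value is never [m_infty]. *)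
- exists 0; intros; discriminate.
Qed.

(** A squeeze between [L - e beta] and [L + e beta], stated generally enough to cover the
    normalization and both the real and imaginary parts of [theta1]. *)
Lemma is_lim_SeriesZ_gauss (a : R -> Z -> R) (c L : R) :
  0 < c ->
  (forall beta k, 0 < beta ->
     Rabs (a beta k) <= exp (- (c * beta) * (2 * IZR k + 1) ^ 2)) ->
  (forall beta, a beta 0%Z + a beta (-1)%Z = exp (- (c * beta)) * L) ->
  is_lim (fun beta => exp (c * beta) * SeriesZ (a beta)) p_infty L.
Proof.
intros hc hbound hlead.
set (e := fun beta => 2 * (exp (- (8 * c * beta)) / (1 - exp (- (8 * c * beta))))).
assert (he : is_lim e p_infty 0).
{ assert (hr := is_lim_exp_neg_lin (8 * c) ltac:(lra)).
  replace (Finite 0) with (Rbar_mult 2 (Rbar_div 0 (Finite (1 - 0))))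
    by (simpl; f_equal; field).
  apply is_lim_scal_l, is_lim_div.
  - exact hr.
  - apply is_lim_minus'; [apply is_lim_const | exact hr].
  - simpl; injection; lra.
  - exact I. }
apply is_lim_le_le_loc with (f := fun beta => L - e beta) (g := fun beta => L + e beta).
- exists 0; intros beta hbeta.
  assert (h := SeriesZ_gauss_tail (a beta) (c * beta) ltac:(nra)
                 (fun k => hbound beta k hbeta)).
  rewrite hlead, <- Rmult_assoc, <- exp_plus, Rplus_opp_r, exp_0, Rmult_1_l,
    <- Rmult_assoc in h.
  apply Rabs_le_between in h; fold (e beta) in h; lra.
- replace (Finite L) with (Finite (L - 0)) by (f_equal; ring).
  apply is_lim_minus'; [apply is_lim_const | exact he].
- replace (Finite L) with (Finite (L + 0)) by (f_equal; ring).
  apply is_lim_plus'; [apply is_lim_const | exact he].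
Qed.

Lemma is_lim_theta_norm (l : R) :
  is_lim (fun beta => exp (PI / 2 * beta) * theta_norm l beta) p_infty (2 * l).
Proof.
replace (Finite (2 * l)) with (Rbar_mult l 2) by (simpl; f_equal; ring).
apply is_lim_ext with
  (fun beta => l * (exp (PI / 2 * beta) * SeriesZ (theta_norm_term beta))).
{ intros beta; unfold theta_norm; ring. }
apply is_lim_scal_l, is_lim_SeriesZ_gauss.
- assert (h := PI_RGT_0); lra.
- intros beta k _; unfold theta_norm_term.
  rewrite Rabs_right by (apply Rle_ge, Rlt_le, exp_pos).
  right; f_equal; field.
- intros beta; unfold theta_norm_term.
  replace (- (PI * beta / 2) * (2 * 0 + 1) ^ 2) with (- (PI / 2 * beta)) by field.
  replace (- (PI * beta / 2) * (2 * -1 + 1) ^ 2) with (- (PI / 2 * beta)) by field.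
  ring.
Qed.

(** The phase splits into a part even in [2 k + 1], carrying [s], and an odd part, carrying [z]. The
    terms [k = 0] and [k = -1] thus share the first and have opposite second parts. *)
Lemma theta1_term_real (z s beta : R) (k : Z) :
  theta1_term (RtoC z) (RtoC s + Ci * beta) k =
  Cexp (- (PI / 4 * beta) * (2 * IZR k + 1) ^ 2,
        PI * s / 4 * (2 * IZR k + 1) ^ 2 + (PI * z + PI / 2) * (2 * IZR k + 1)).
Proof.
unfold theta1_term; f_equal.
apply injective_projections;
  unfold Cdiv, Cinv, Cmult, Cplus, Ci, RtoC; simpl; field.
Qed.

Lemma Cmod_theta1_term_real (z s beta : R) (k : Z) :
  Cmod (theta1_term (RtoC z) (RtoC s + Ci * beta) k) = exp (- (PI / 4 * beta) * (2 * IZR k + 1) ^ 2).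
Proof. now rewrite theta1_term_real, Cmod_Cexp. Qed.

Lemma theta1_term_0 (z s beta : R) :
  theta1_term (RtoC z) (RtoC s + Ci * beta) 0 =
  Cexp (- (PI / 4 * beta), PI * s / 4 + (PI * z + PI / 2)).
Proof. rewrite theta1_term_real; do 2 f_equal; ring. Qed.

Lemma theta1_term_m1 (z s beta : R) :
  theta1_term (RtoC z) (RtoC s + Ci * beta) (-1) =
  Cexp (- (PI / 4 * beta), PI * s / 4 - (PI * z + PI / 2)).
Proof. rewrite theta1_term_real; do 2 f_equal; ring. Qed.

Lemma is_lim_Re_theta1 (z s : R) :
  is_lim (fun beta => exp (PI / 4 * beta) * Re (theta1 (RtoC z) (RtoC s + Ci * beta)))
    p_infty (- 2 * cos (PI * s / 4) * sin (PI * z)).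
Proof.
apply (is_lim_SeriesZ_gauss (fun beta k => Re (theta1_term (RtoC z) (RtoC s + Ci * beta) k))).
- assert (h := PI_RGT_0); lra.
- intros beta k _; rewrite <- (Cmod_theta1_term_real z s); apply re_le_Cmod.
- intros beta; rewrite theta1_term_0, theta1_term_m1; unfold Cexp, Re, Im; cbn [fst snd].
  (* The two cosines add up to [2 cos (PI s / 4) cos (PI z + PI / 2)], and the last factor is
     [- sin (PI z)]. *)
  rewrite cos_plus, cos_minus, (cos_plus (PI * z)), cos_PI2, sin_PI2; ring.
Qed.

Lemma is_lim_Im_theta1 (z s : R) :
  is_lim (fun beta => exp (PI / 4 * beta) * Im (theta1 (RtoC z) (RtoC s + Ci * beta)))
    p_infty (- 2 * sin (PI * s / 4) * sin (PI * z)).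
Proof.
apply (is_lim_SeriesZ_gauss (fun beta k => Im (theta1_term (RtoC z) (RtoC s + Ci * beta) k))).
- assert (h := PI_RGT_0); lra.
- intros beta k _; rewrite <- (Cmod_theta1_term_real z s); apply (Rle_trans _ _ _ (Rmax_r _ _) (Rmax_Cmod _)).
- intros beta; rewrite theta1_term_0, theta1_term_m1; unfold Cexp, Re, Im; cbn [fst snd].
  rewrite sin_plus, sin_minus, (cos_plus (PI * z)), cos_PI2, sin_PI2; ring.
Qed.

Theorem theorem3 (m l hbar : R) (mu : nat) (x t : R)
  (hm : 0 < m) (hl : 0 < l) (hhbar : 0 < hbar) (hmu : (1 <= mu)%nat)
  (hx : 0 <= x <= l) :
  is_lim (fun beta : R => density m l hbar mu beta x t) p_infty
         (Finite (box_density l mu x)).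
Proof.
set (z := INR mu * (x / l)).
set (s := - (INR mu ^ 2) * (2 * PI * hbar / (m * l ^ 2)) * t).
assert (hU := is_lim_Re_theta1 z s).
assert (hV := is_lim_Im_theta1 z s).
assert (hN := is_lim_theta_norm l).
set (U := fun beta : R => exp (PI / 4 * beta) * Re (theta1 (RtoC z) (RtoC s + Ci * beta))) in hU.
set (V := fun beta : R => exp (PI / 4 * beta) * Im (theta1 (RtoC z) (RtoC s + Ci * beta))) in hV.
set (W := fun beta => exp (PI / 2 * beta) * theta_norm l beta) in hN.
set (A := - 2 * cos (PI * s / 4) * sin (PI * z)) in hU.
set (B := - 2 * sin (PI * s / 4) * sin (PI * z)) in hV.
(* Time enters [A] and [B] only through [s], which disappears by [sin^2 + cos^2 = 1]. *)
assert (hbox : box_density l mu x = (A * A + B * B) / (2 * l)).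
{ unfold box_density.
  replace (PI * INR mu / l * x) with (PI * z) by (unfold z; field; lra).
  assert (h := sin2_cos2 (PI * s / 4)); unfold Rsqr in h.
  replace (A * A + B * B) with
    (4 * sin (PI * z) ^ 2 * (sin (PI * s / 4) * sin (PI * s / 4)
                             + cos (PI * s / 4) * cos (PI * s / 4)))
    by (unfold A, B; ring).
  rewrite h; field; lra. }
rewrite hbox.
apply is_lim_ext_loc with (fun beta => (U beta * U beta + V beta * V beta) / W beta).
(* Squaring [1 / sqrt (theta_norm l beta)] needs a positive norm; this holds for large [beta]
   because [W] tends to [2 * l > 0]. *)
- assert (hW : Rbar_locally' p_infty (fun beta => 0 < W beta)).
  { apply (hN (fun y => 0 < y)), open_gt; lra. }
  destruct hW as [M hW]; exists M; intros beta hbeta.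
  specialize (hW beta hbeta).
  assert (hpos : 0 < theta_norm l beta).
  { apply Rmult_lt_reg_l with (exp (PI / 2 * beta)); [apply exp_pos|].
    rewrite Rmult_0_r; exact hW. }
  unfold density, Psi; fold z s.
  rewrite Cmod_mult, Cmod_R, Rpow_mult_distr, pow2_abs, Cmod2_alt.
  replace ((1 / sqrt (theta_norm l beta)) ^ 2) with (/ theta_norm l beta).
  + unfold U, V, W.
    (* The scaling of [W] is the square of that of [U] and [V], so it cancels in the quotient. *)
    replace (exp (PI / 2 * beta)) with (exp (PI / 4 * beta) * exp (PI / 4 * beta))
      by (rewrite <- exp_plus; f_equal; field).
    field; split; [lra | apply Rgt_not_eq, exp_pos].
  + rewrite <- (pow2_sqrt (theta_norm l beta)) at 1 by lra.
    field; apply Rgt_not_eq, sqrt_lt_R0, hpos.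
- apply (is_lim_div _ _ p_infty (A * A + B * B) (2 * l)).
  + apply is_lim_plus'; apply (is_lim_mult _ _ _ (Finite _) (Finite _)); easy.
  + exact hN.
  + injection; lra.
  + exact I.
Qed.
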